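(* Let $F:\mathbb{R}^+\to\mathbb{R}$ be strictly increasing, and let $(L(t),M(t))$, $t\in\mathbb{R}$, be the solution of the generalized finite relativistic Toda lattice $$\dot L=\bigl(F(LM^{-1})\bigr)_-L-L\bigl(F(M^{-1}L)\bigr)_-,\qquad \dot M=\bigl(F(LM^{-1})\bigr)_-M-M\bigl(F(M^{-1}L)\bigr)_-$$ with positive initial data $a_n(0)>0$, $b_n(0)>0$. Then for $1\le n\le N-1$, $$b_n(t)=\frac{w_{n+1}(0)}{w_n(0)}\,\frac{\lambda_n^{\,n-1}}{\lambda_{n+1}^{\,n}}\left(\frac{\prod_{i=1}^{n}(\lambda_{n+1}-\lambda_i)}{\prod_{i=1}^{n-1}(\lambda_n-\lambda_i)}\right)^2e^{-t(F(\lambda_{n+1})-F(\lambda_n))}\bigl(1+o(1)\bigr)\quad\text{as } t\to+\infty,$$ and $$b_n(t)=\frac{w_{N-n}(0)\,\lambda_{N-n+1}^{\,n-1}}{w_{N-n+1}(0)\,\lambda_{N-n}^{\,n}}\left(\frac{\prod_{i=N-n+1}^{N}(\lambda_{N-n}-\lambda_i)}{\prod_{i=N-n+2}^{N}(\lambda_{N-n+1}-\lambda_i)}\right)^2e^{t(F(\lambda_{N-n+1})-F(\lambda_{N-n}))}\bigl(1+o(1)\bigr)\quad\text{as } t\to-\infty.$$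
   Context: $\mathbb{R}^+=(0,\infty)$. For matrix data $a_1,\ldots,a_N>0$ and $b_1,\ldots,b_{N-1}>0$ (functions of $t$), $L$ is the $N\times N$ upper bidiagonal matrix with $L_{n,n}=a_n$, $L_{n,n+1}=1$, all other entries $0$; $M$ is the $N\times N$ lower bidiagonal matrix with $M_{n,n}=1$, $M_{n+1,n}=-b_n$, all other entries $0$. The solution of the system with positive initial data exists uniquely for all $t\in\mathbb{R}$ with $a_n(t)>0$, $b_n(t)>0$. For a square matrix $X$, $X_-$ denotes its strictly lower triangular part. The generalized eigenvalue problem $L\vec x=\lambda M\vec x$ has $N$ distinct positive eigenvalues $0<\lambda_1<\cdots<\lambda_N$ (the zeros of $\det(zM-L)$), which are also the eigenvalues of the diagonalizable matrices $LM^{-1}$ and $M^{-1}L$; along solutions of the system they do not depend on $t$. For a diagonalizable matrix $X=S\,\mathrm{diag}(\lambda_1,\ldots,\lambda_N)S^{-1}$ with positive eigenvalues, $F(X)=S\,\mathrm{diag}(F(\lambda_1),\ldots,F(\lambda_N))S^{-1}$. For each $j$ let $\vec v_j$ and $\vec u_j$ be the right and left eigenvectors, $L\vec v_j=\lambda_jM\vec v_j$ and $\vec u_j^{\,T}L=\lambda_j\vec u_j^{\,T}M$, both normalized to have first component $1$ (always possible); then $\vec u_j^{\,T}M\vec v_j\neq0$ and $w_j=(\vec u_j^{\,T}M\vec v_j)^{-1}$. $w_j(0)$ denotes $w_j$ for the pair $(L(0),M(0))$. Empty products equal $1$. *)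

(* Defs.v *)
(* The sequences a_n, b_n, lambda_n, ... are functions on nat
   with 1-based indices, of which only the relevant range matters. *)
From HB Require Import structures.
From mathcomp Require Import all_boot all_order all_algebra.
From mathcomp Require Import all_classical all_reals all_analysis.
Set Implicit Arguments.
Unset Strict Implicit.
Unset Printing Implicit Defensive.
Import Order.TTheory GRing.Theory Num.Theory.
Import numFieldNormedType.Exports.
Local Open Scope classical_set_scope.
Local Open Scope ring_scope.

Section Defs.
Variables (R : realType) (N : nat).

(* Matrix row (or column) n has ordinal n - 1. *)
Definition Lmx (a : nat -> R) : 'M[R]_N :=
  \matrix_(i, j) if i == j then a i.+1
                 else if j == i.+1 :> nat then 1 else 0.

Definition Mmx (b : nat -> R) : 'M[R]_N :=
  \matrix_(i, j) if i == j then 1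
                 else if i == j.+1 :> nat then - b j.+1 else 0.

Definition strict_lower (X : 'M[R]_N) : 'M[R]_N :=
  \matrix_(i, j) if (j < i)%N then X i j else 0.

(* Y = F(X), for X diagonalizable over R with positive eigenvalues; F is only
   evaluated at positive reals. *)
Definition is_matfun (F : R -> R) (X Y : 'M[R]_N) : Prop :=
  exists (S : 'M[R]_N) (d : 'rV[R]_N),
    [/\ S \in unitmx, forall j, 0 < d 0 j,
        X = S *m diag_mx d *m invmx S &
        Y = S *m diag_mx (map_mx F d) *m invmx S].

(* The value does not depend on the diagonalization (matfunE); the default 0 is
   taken only when X is not diagonalizable with positive eigenvalues. *)
Definition matfun (F : R -> R) (X : 'M[R]_N) : 'M[R]_N :=
  xget 0 [set Y | is_matfun F X Y].

Lemma is_matfun_uniq F X Y1 Y2 :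
  is_matfun F X Y1 -> is_matfun F X Y2 -> Y1 = Y2.
Proof.
move=> [S [d [uS _ XS ->]]] [T [e [uT _ XT ->]]].
set P := invmx T *m S.
have SP : S = T *m P by rewrite /P mulmxA mulmxV // mul1mx.
have PV : P *m invmx S = invmx T by rewrite /P -mulmxA mulmxV // mulmx1.
have comm : P *m diag_mx d = diag_mx e *m P.
  have := congr1 (fun Z => invmx T *m Z *m S) (etrans (esym XS) XT).
  by rewrite !mulmxA mulVmx // mul1mx -!mulmxA mulVmx // mulmx1 !mulmxA.
clearbody P.
have commF : P *m diag_mx (map_mx F d) = diag_mx (map_mx F e) *m P.
  apply/matrixP => i j; have := congr1 (fun Z : 'M[R]_N => Z i j) comm.
  rewrite !mul_mx_diag !mul_diag_mx !mxE => h.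
  have [P0|P0] := eqVneq (P i j) 0; first by rewrite P0 mulr0 mul0r.
  by rewrite mulrC; congr (F _ * _); apply: (mulfI P0); rewrite h mulrC.
by rewrite {1}SP -[T *m P *m _]mulmxA commF -!mulmxA PV.
Qed.

Lemma matfunE F X Y : is_matfun F X Y -> matfun F X = Y.
Proof.
by move=> XY; apply: xget_unique => // Z XZ; apply: is_matfun_uniq XZ XY.
Qed.

(* (L, M) solves, for all t, the system
     L' = F(L M^-1)_- L - L F(M^-1 L)_-,  M' = F(L M^-1)_- M - M F(M^-1 L)_-,
   the derivatives being taken entrywise. *)
Definition toda_solution (F : R -> R) (a b : nat -> R -> R) : Prop :=
  let L t := Lmx (fun n => a n t) in
  let M t := Mmx (fun n => b n t) in
  forall (t : R),
    let A := strict_lower (matfun F (L t *m invmx (M t))) in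
    let B := strict_lower (matfun F (invmx (M t) *m L t)) in
    forall i j : 'I_N,
      is_derive t 1 (fun s => L s i j) ((A *m L t - L t *m B) i j) /\
      is_derive t 1 (fun s => M s i j) ((A *m M t - M t *m B) i j).

Definition gen_eigenvalues (L M : 'M[R]_N) (lam : nat -> R) : Prop :=
  [/\ forall j, (1 <= j <= N)%N -> 0 < lam j,
      forall j, (1 <= j < N)%N -> lam j < lam j.+1 &
      forall z, \det (z *: M - L) = 0 <->
                exists2 j, (1 <= j <= N)%N & z = lam j].

Definition first_comp_one (x : 'cV[R]_N) : Prop :=
  forall i : 'I_N, i = 0%N :> nat -> x i 0 = 1.

Definition right_eigvec (L M : 'M[R]_N) (z : R) (v : 'cV[R]_N) : Prop :=
  L *m v = z *: (M *m v) /\ first_comp_one v.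

Definition left_eigvec (L M : 'M[R]_N) (z : R) (u : 'cV[R]_N) : Prop :=
  u^T *m L = z *: (u^T *m M) /\ first_comp_one u.

Definition weight (M : 'M[R]_N) (u v : 'cV[R]_N) : R :=
  ((u^T *m M *m v) 0 0)^-1.

End Defs.

Arguments Lmx {R} N a.
Arguments Mmx {R} N b.
Arguments toda_solution {R} N F a b.

(* Main.v *)
(* For [A], [B] strictly lower triangular, [L' = A L - L B] and
   [M' = A M - M B] keep the eigenvalues of [L x = z M x] fixed, and the
   eigenvectors normalized by [x_1 = 1] satisfy [x' = B x].  If [V] is the matrix
   of these eigenvectors, the weights are [w = (M V)^-1 e_1]; since
   [(M V)' = A M V], they satisfy [w_j' = (h - F(lambda_j)) w_j] with the same
   function [h] for all [j], so that [w_j(t)] is [w_j(0) exp(- t F(lambda_j))] up to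
   a factor independent of [j].  With the Toeplitz determinants
   [H_m = det (sum_j w_j lambda_j^(i-k))_(i, k < m)], and [H'_m] formed with the
   weights [w_j / lambda_j], one has [b_n H_n H'_n = - H_(n+1) H'_(n-1)]; both sides
   are homogeneous of the same degree in [w], which removes the common factor.
   Finally, as [t] tends to [+oo] (resp. [-oo]), [H_m] is dominated by its terms
   that use only the [m] smallest (resp. largest) eigenvalues, and these add up to
   a product of two Vandermonde determinants. *)
Require Import Defs.
From HB Require Import structures.
From mathcomp Require Import all_boot all_order all_algebra.
From mathcomp Require Import all_classical all_reals all_analysis.
From mathcomp Require Import fingroup perm.
From mathcomp Require Import ring zify.
Set Implicit Arguments.
Unset Strict Implicit.
Unset Printing Implicit Defensive.
Import Order.TTheory GRing.Theory Num.Theory.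
Import numFieldNormedType.Exports.
Local Open Scope classical_set_scope.
Local Open Scope ring_scope.

(** * Entrywise derivatives of matrix functions *)

Section MatrixDerivative.
Variable R : realType.
Implicit Types (t : R).

Lemma is_derive_mulf (f g : R -> R) t df dg :
  is_derive t 1 f df -> is_derive t 1 g dg ->
  is_derive t 1 (fun s => f s * g s) (df * g t + f t * dg).
Proof.
move=> hf hg; apply: (is_derive_eq (is_deriveM hf hg)).
by rewrite addrC; congr (_ + _); exact: mulrC.
Qed.

Lemma derivable_addf (f g : R -> R) t :
  derivable f t 1 -> derivable g t 1 -> derivable (fun s => f s + g s) t 1.
Proof. exact: derivableD. Qed.

Lemma derivable_mulf (f g : R -> R) t :
  derivable f t 1 -> derivable g t 1 -> derivable (fun s => f s * g s) t 1.
Proof. exact: derivableM. Qed.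

Lemma derivable_bigsum I (r : seq I) (P : pred I) (h : I -> R -> R) t :
  (forall i, P i -> derivable (h i) t 1) ->
  derivable (fun s => \sum_(i <- r | P i) h i s) t 1.
Proof.
move=> dh; elim: r => [|i r IHr].
  by under eq_fun do rewrite big_nil; exact: derivable_cst.
under eq_fun do rewrite big_cons.
case: ifP => [Pi|_]; last exact: IHr.
exact: derivable_addf (dh _ Pi) IHr.
Qed.

Lemma derivable_bigprod I (r : seq I) (h : I -> R -> R) t :
  (forall i, derivable (h i) t 1) ->
  derivable (fun s => \prod_(i <- r) h i s) t 1.
Proof.
move=> dh; elim: r => [|i r IHr].
  by under eq_fun do rewrite big_nil; exact: derivable_cst.
under eq_fun do rewrite big_cons.
exact: derivable_mulf (dh i) IHr.
Qed.

Lemma is_derive_bigsum n (h : 'I_n -> R -> R) (dh : 'I_n -> R) t :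
  (forall i, is_derive t 1 (h i) (dh i)) ->
  is_derive t 1 (fun s => \sum_(i < n) h i s) (\sum_(i < n) dh i).
Proof.
move=> hd; rewrite (_ : (fun _ => _) = \sum_(i < n) h i); first exact: is_derive_sum.
by apply/funext => s; rewrite fct_sumE.
Qed.

Lemma is_derive_unique (f : R -> R) t d1 d2 :
  is_derive t 1 f d1 -> is_derive t 1 f d2 -> d1 = d2.
Proof. by move=> h1 h2; rewrite -(@derive_val _ _ _ _ _ _ _ h1) (@derive_val _ _ _ _ _ _ _ h2). Qed.

Definition mx_derive m n t (C : R -> 'M[R]_(m, n)) (dC : 'M[R]_(m, n)) :=
  forall i j, is_derive t 1 (fun s => C s i j) (dC i j).

Lemma mx_derive_unique m n t (C : R -> 'M[R]_(m, n)) d1 d2 :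
  mx_derive t C d1 -> mx_derive t C d2 -> d1 = d2.
Proof. by move=> h1 h2; apply/matrixP => i j; apply: is_derive_unique (h1 i j) (h2 i j). Qed.

Lemma mx_derive_cst m n t (C : 'M[R]_(m, n)) : mx_derive t (fun=> C) 0.
Proof. by move=> i j; rewrite mxE; exact: is_derive_cst. Qed.

Lemma mx_deriveM m n p t (C : R -> 'M[R]_(m, n)) (D : R -> 'M[R]_(n, p)) dC dD :
  mx_derive t C dC -> mx_derive t D dD ->
  mx_derive t (fun s => C s *m D s) (dC *m D t + C t *m dD).
Proof.
move=> hC hD i j.
under eq_fun do rewrite mxE.
rewrite !mxE -big_split /=.
by apply: is_derive_bigsum => k; apply: is_derive_mulf.
Qed.

Lemma mx_deriveB m n t (C D : R -> 'M[R]_(m, n)) dC dD :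
  mx_derive t C dC -> mx_derive t D dD ->
  mx_derive t (fun s => C s - D s) (dC - dD).
Proof.
move=> hC hD i j.
under eq_fun do rewrite !mxE.
rewrite !mxE; apply: is_deriveB; [exact: hC|exact: hD].
Qed.

Lemma mx_deriveZ m n t (c : R -> R) dc (C : 'M[R]_(m, n)) :
  is_derive t 1 c dc -> mx_derive t (fun s => c s *: C) (dc *: C).
Proof.
move=> hc i j; rewrite mxE mulrC.
under eq_fun do rewrite !mxE mulrC.
exact: is_deriveZ.
Qed.

Lemma mx_deriveZl m n t (c : R) (C : R -> 'M[R]_(m, n)) dC :
  mx_derive t C dC -> mx_derive t (fun s => c *: C s) (c *: dC).
Proof.
move=> hc i j; rewrite mxE; under eq_fun do rewrite mxE.
exact: is_deriveZ.
Qed.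

Lemma derivable_det n t (C : R -> 'M[R]_n) :
  (forall i j, derivable (fun s => C s i j) t 1) ->
  derivable (fun s => \det (C s)) t 1.
Proof.
move=> hC; rewrite /determinant; apply: derivable_bigsum => s _.
by apply: derivable_mulf; [exact: derivable_cst|exact: derivable_bigprod].
Qed.

(** By Cramer's rule the entries are cofactors divided by the determinant. Invertibility at every
    [s] lets [invmx] unfold to this formula as a function, not only at [t]. *)
Lemma mx_derivable_invmx n t (C : R -> 'M[R]_n) :
  (forall i j, derivable (fun s => C s i j) t 1) ->
  (forall s, C s \in unitmx) ->
  forall i j, derivable (fun s => invmx (C s) i j) t 1.
Proof.
move=> hC uC i j; rewrite /invmx; under eq_fun do rewrite uC !mxE.
apply: derivable_mulf.
  apply: derivableV; last exact: derivable_det.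
  by have := uC t; rewrite unitmxE unitfE.
rewrite /cofactor; apply: derivable_mulf; first exact: derivable_cst.
apply: derivable_det => k l.
under eq_fun do rewrite !mxE.
exact: hC.
Qed.

End MatrixDerivative.

(** * The bidiagonal pencil and its three-term recurrence *)

Section Bidiagonal.
Variables (R : realType) (N : nat) (a b : nat -> R).
Implicit Types (m : nat) (i j : 'I_N).

Lemma mul_Lmx_lt m (Y : 'M[R]_(N, m)) i j k : j = i.+1 :> nat ->
  (Lmx N a *m Y) i k = a i.+1 * Y i k + Y j k.
Proof.
move=> ij; have neq_ij : i != j by rewrite -val_eqE /= ij; lia.
rewrite mxE (bigD1 i) //= (bigD1 j) 1?eq_sym //= !mxE eqxx (negbTE neq_ij) ij eqxx mul1r.
rewrite big1 ?addr0 // => l /andP[li lj].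
rewrite mxE eq_sym (negbTE li) -ij.
by move: lj; rewrite -val_eqE => /negbTE ->; rewrite mul0r.
Qed.

Lemma mul_Lmx_last m (Y : 'M[R]_(N, m)) i k : i.+1 = N ->
  (Lmx N a *m Y) i k = a i.+1 * Y i k.
Proof.
move=> iN; rewrite mxE (bigD1 i) //= !mxE eqxx big1 ?addr0 // => l li.
rewrite mxE eq_sym (negbTE li).
by case: eqP => [lE|]; [have := ltn_ord l; lia|rewrite mul0r].
Qed.

Lemma mul_Mmx0 m (Y : 'M[R]_(N, m)) i k : i = 0%N :> nat ->
  (Mmx N b *m Y) i k = Y i k.
Proof.
move=> i0; rewrite mxE (bigD1 i) //= !mxE eqxx mul1r big1 ?addr0 // => l li.
by rewrite mxE eq_sym (negbTE li) i0 mul0r.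
Qed.

Lemma mul_MmxS m (Y : 'M[R]_(N, m)) i j k : i = j.+1 :> nat ->
  (Mmx N b *m Y) i k = Y i k - b i * Y j k.
Proof.
move=> ij; have neq_ij : i != j by rewrite -val_eqE /= ij; lia.
rewrite mxE (bigD1 i) //= (bigD1 j) 1?eq_sym //= !mxE eqxx (negbTE neq_ij) ij eqxx.
rewrite mul1r mulNr big1 ?addr0 // => l /andP[li lj].
rewrite mxE eq_sym (negbTE li) ij eqSS.
by move: lj; rewrite -val_eqE eq_sym => /negbTE ->; rewrite mul0r.
Qed.

Lemma det_Mmx : \det (Mmx N b) = 1.
Proof.
rewrite det_trig; first by rewrite big1 // => i _; rewrite mxE eqxx.
apply/is_trig_mxP => i j ij; rewrite mxE.
case: eqVneq => [eij|_]; first by rewrite eij ltnn in ij.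
by case: eqP => // eij; rewrite eij in ij; lia.
Qed.

Lemma unitmx_Mmx : Mmx N b \in unitmx.
Proof. by rewrite unitmxE det_Mmx unitr1. Qed.

(* The eigenvector equation [L x = z M x] with first component 1 forces
   the components of x to be values of these monic Laurent orthogonal
   polynomials; its last row says that z is a root of [lpoly N]. *)
Fixpoint lpoly k : {poly R} :=
  match k with
  | 0 => 1
  | k'.+1 => ('X - (a k'.+1)%:P) * lpoly k' -
      (b k')%:P * 'X * match k' with 0 => 0 | k''.+1 => lpoly k'' end
  end.

Lemma lpoly1 : lpoly 1 = 'X - (a 1)%:P.
Proof. by rewrite /= mulr1 mulr0 subr0. Qed.

Lemma lpolySS k : lpoly k.+2 =
  ('X - (a k.+2)%:P) * lpoly k.+1 - (b k.+1)%:P * 'X * lpoly k.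
Proof. by []. Qed.

Lemma horner_lpolySS k z : (lpoly k.+2).[z] =
  (z - a k.+2) * (lpoly k.+1).[z] - b k.+1 * z * (lpoly k).[z].
Proof. by rewrite lpolySS !(hornerD, hornerN, hornerM, hornerC, hornerX). Qed.

Lemma lpoly_monic_size k : (lpoly k \is monic) /\ size (lpoly k) = k.+1.
Proof.
elim/ltn_ind: k => -[_|[_|k IH]].
- by rewrite /= monic1 size_poly1.
- by rewrite lpoly1 monicXsubC size_XsubC.
have [m1 s1] := IH k.+1 (ltnSn _); have [_ s0] := IH k (ltnW (ltnSn _)).
have sP : size (('X - (a k.+2)%:P) * lpoly k.+1) = k.+3.
  by rewrite size_monicM ?monicXsubC ?monic_neq0 // size_XsubC s1.
have sQ : (size (- ((b k.+1)%:P * 'X * lpoly k)) < k.+3)%N.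
  rewrite size_polyN -mulrA mul_polyC; apply: leq_ltn_trans (size_scale_leq _ _) _.
  by rewrite mulrC size_mulX ?s0 // -size_poly_gt0 s0.
rewrite lpolySS; split; last by rewrite size_polyDl sP.
by rewrite monicE lead_coefDl ?sP // -monicE monicMl ?monicXsubC.
Qed.

(** At 0 the [b] term of the recurrence drops out. Since [lpoly N] will turn out to be conserved,
    this keeps every [a k] nonzero along the flow. *)
Lemma lpoly_horner0 k : (lpoly k).[0] = \prod_(1 <= l < k.+1) - a l.
Proof.
elim/ltn_ind: k => -[_|[_|k IH]].
- by rewrite big_geq //= hornerC.
- by rewrite big_nat1 lpoly1 hornerXsubC sub0r.
by rewrite horner_lpolySS big_nat_recr //= -IH //; ring.
Qed.

Definition lvec z : 'cV[R]_N := \col_i (lpoly i).[z].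

(** Row [i] of the pencil expresses component [i + 1] through the earlier ones, by the recurrence of
    [lpoly]. The last row is left out, so that the lemma covers every [z] and vectors whose residual
    sits in the last coordinate. *)
Lemma eig_lvec z (y : 'cV[R]_N) (i0 : 'I_N) : i0 = 0%N :> nat ->
  (forall i, (i.+1 < N)%N -> (Lmx N a *m y) i 0 = z * (Mmx N b *m y) i 0) ->
  y = y i0 0 *: lvec z.
Proof.
move=> i00 hy; apply/matrixP => i c; rewrite (ord1 c) !mxE {c}.
move: i; suff H k : forall i, i = k :> nat -> y i 0 = y i0 0 * (lpoly i).[z] by move=> i; exact: H.
elim/ltn_ind: k => -[|[|k]] IH i ik.
- have -> : i = i0 by apply/val_inj; rewrite /= ik.
  by rewrite i00 hornerC mulr1.
- have ltN : (i0.+1 < N)%N by rewrite i00 -ik.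
  have := hy i0 ltN.
  rewrite (@mul_Lmx_lt _ _ _ i) ?ik ?i00 // mul_Mmx0 // => E.
  rewrite lpoly1 hornerXsubC mulrBr [_ * z]mulrC -E; ring.
have k1N : (k.+1 < N)%N by rewrite ltnW // -ik.
have k0N : (k < N)%N by rewrite ltnW.
have kltN : ((Ordinal k1N).+1 < N)%N by rewrite /= -ik.
have := hy _ kltN.
rewrite (@mul_Lmx_lt _ _ _ i) //= (@mul_MmxS _ _ _ (Ordinal k0N)) //=.
rewrite (IH k.+1 _ (Ordinal k1N)) // (IH k _ (Ordinal k0N)) //= => /(canRL (addKr _)) ->.
by rewrite ik horner_lpolySS; move: (lpoly k.+1).[z] => p; ring.
Qed.

(** Row [i] is the recurrence for [lpoly i.+1]; the last row of [L] has no superdiagonal 1, so there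
    the term [lpoly N] is left over. *)
Lemma lvec_res z i : (Lmx N a *m lvec z) i 0 - z * (Mmx N b *m lvec z) i 0 =
  - (lpoly N).[z] *+ (i.+1 == N).
Proof.
have rowE : a i.+1 * (lpoly i).[z] + (lpoly i.+1).[z] = z * (Mmx N b *m lvec z) i 0.
  case: i => -[|k] kN.
    rewrite mul_Mmx0 // mxE lpoly1 hornerXsubC hornerC; ring.
  have kN' : (k < N)%N by rewrite ltnW.
  rewrite (@mul_MmxS _ _ _ (Ordinal kN')) // !mxE horner_lpolySS /=.
    by move: (lpoly k).[z] (lpoly k.+1).[z] => p q; ring.
have [iN|iN] := eqVneq i.+1 N.
  have -> : lpoly N = lpoly i.+1 by rewrite iN.
  by rewrite mul_Lmx_last // mxE -rowE mulr1n opprD addNKr.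
have iN' : (i.+1 < N)%N by rewrite ltn_neqAle iN ltn_ord.
by rewrite (@mul_Lmx_lt _ _ _ (Ordinal iN')) // -rowE !mxE /= subrr.
Qed.

End Bidiagonal.

(** * Isospectrality and the flow of the eigenvectors *)

Section Flow.
Variables (R : realType) (n : nat).
Local Notation N := n.+1.
Variables (a b : nat -> R -> R).
Local Notation L s := (Lmx N (a^~ s)).
Local Notation M s := (Mmx N (b^~ s)).

Definition strictly_lower (A : 'M[R]_N) := forall i j : 'I_N, (i <= j)%N -> A i j = 0.

Lemma mul_strictly_lower0 m (A : 'M[R]_N) (Y : 'M[R]_(N, m)) k :
  strictly_lower A -> (A *m Y) ord0 k = 0.
Proof.
by move=> lowA; rewrite mxE big1 // => j _; rewrite lowA ?mul0r.
Qed.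

Lemma strict_lower_lower (A : 'M[R]_N) : strictly_lower (strict_lower A).
Proof. by move=> i j ij; rewrite mxE ltnNge ij. Qed.

(* [L' = A L - L B] and [M' = A M - M B] with strictly lower triangular [A]
   and [B], which is all that isospectrality requires. *)
Variables (t : R) (A B : 'M[R]_N).
Hypotheses (lowA : strictly_lower A) (lowB : strictly_lower B).
Hypothesis dL : mx_derive t (fun s => L s) (A *m L t - L t *m B).
Hypothesis dM : mx_derive t (fun s => M s) (A *m M t - M t *m B).

Lemma derivable_a k : (k < N)%N -> derivable (a k.+1) t 1.
Proof.
move=> kN; have [+ _] := dL (Ordinal kN) (Ordinal kN).
by under eq_fun do rewrite mxE eqxx.
Qed.

Lemma derivable_b k : (k.+1 < N)%N -> derivable (b k.+1) t 1.
Proof.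
move=> kN; have [+ _] := dM (Ordinal kN) (Ordinal (ltnW kN)).
under eq_fun do rewrite mxE -val_eqE /= eqn_leq ltnn eqxx.
by move=> /derivableN; under [X in derivable X]eq_fun do rewrite /= opprK.
Qed.

Lemma derivable_lpoly z k : (k <= N)%N ->
  derivable (fun s => (lpoly (a^~ s) (b^~ s) k).[z]) t 1.
Proof.
elim/ltn_ind: k => -[_|[_|k IH]] kN.
- by under eq_fun do rewrite /= hornerC; exact: derivable_cst.
- under eq_fun do rewrite lpoly1 hornerXsubC.
  by apply: derivable_addf; [exact: derivable_cst|exact/derivableN/derivable_a].
under eq_fun do rewrite horner_lpolySS -mulNr.
have dP := IH k.+1 (ltnSn _) (ltnW kN).
have dQ := IH k (ltnW (ltnSn _)) (ltnW (ltnW kN)).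
apply: derivable_addf; apply: derivable_mulf; [|exact: dP| |exact: dQ].
  by apply: derivable_addf; [exact: derivable_cst|exact/derivableN/derivable_a].
apply/derivableN/derivable_mulf; last exact: derivable_cst.
exact: derivable_b.
Qed.

Local Notation x s z := (lvec N (a^~ s) (b^~ s) z).

(** With [e = - e_N], differentiating [(L - z M) x = p e] gives
    [p A e + (L - z M) (x' - B x) = p' e], where [A e = 0]. So [x' - B x] satisfies all rows but the
    last of the homogeneous system; its first component is 0, hence it vanishes, and the last row
    leaves [p' = 0]. *)
Lemma lvec_flow z :
  mx_derive t (fun s => x s z) (B *m x t z) /\
  is_derive t 1 (fun s => (lpoly (a^~ s) (b^~ s) N).[z]) 0.
Proof.
pose p s := (lpoly (a^~ s) (b^~ s) N).[z].
pose dx : 'cV[R]_N := \col_i 'D_1 (fun s => x s z i 0) t.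
have hx : mx_derive t (fun s => x s z) dx.
  move=> i j; rewrite mxE (ord1 j); apply: derivableP.
  under eq_fun do rewrite mxE; apply: derivable_lpoly; exact: ltnW.
have hp : is_derive t 1 p ('D_1 p t) by exact/derivableP/derivable_lpoly.
pose e : 'cV[R]_N := - delta_mx ord_max 0.
have resE s : L s *m x s z - z *: (M s *m x s z) = p s *: e.
  apply/matrixP => i c; rewrite (ord1 c) mxE [X in _ + X]mxE [X in _ - X]mxE lvec_res.
  by rewrite !mxE eqxx andbT -val_eqE /= eqSS mulrN mulr_natr mulNrn.
have := mx_derive_unique (mx_deriveB (mx_deriveM dL hx) (mx_deriveZl z (mx_deriveM dM hx))).
under [X in mx_derive _ X]eq_fun do rewrite resE.
move=> /(_ _ (mx_deriveZ e hp)).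
set q := 'D_1 p t => E.
(* The last column of a strictly lower triangular matrix is zero. *)
have AeE : A *m e = 0.
  rewrite mulmxN -colE; apply/matrixP => i j.
  by rewrite !mxE lowA ?oppr0 // -ltnS.
pose y := dx - B *m x t z.
have Ey : L t *m y - z *: (M t *m y) = q *: e.
  rewrite -E !mulmxBr !mulmxBl -!mulmxA.
  have : A *m (L t *m x t z - z *: (M t *m x t z)) = 0.
    by rewrite resE -scalemxAr AeE scaler0.
  rewrite mulmxBr -scalemxAr => /eqP; rewrite subr_eq0 => /eqP ->.
  rewrite !(scalerDr, scalerN).
  set u1 := L t *m (B *m _); set u2 := M t *m (B *m _).
  rewrite !opprD !opprK.
  move: (z *: (A *m _)) (L t *m dx) (z *: (M t *m dx)) (z *: u2) => u3 u4 u5 u6.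
  by apply/matrixP => i j; rewrite !mxE; ring.
(* The first component of [x] is constantly 1 and the first row of [B] is zero, so [eig_lvec]
   exhibits [y] as a zero multiple. *)
have y0 : y = 0.
  rewrite (@eig_lvec _ _ (a^~ t) (b^~ t) z y ord0) //.
    rewrite !mxE; under eq_fun do rewrite mxE /= hornerC.
    rewrite derive_cst sub0r; have := @mul_strictly_lower0 _ _ (x t z) 0 lowB.
    by rewrite mxE => ->; rewrite oppr0 scale0r.
  move=> i iN; have /matrixP/(_ i 0) := Ey.
  rewrite mxE [X in _ + X]mxE [X in _ - X]mxE => /eqP; rewrite subr_eq => /eqP ->.
  rewrite !mxE -val_eqE /= (@ltn_eqF i n iN).
  by rewrite oppr0 mulr0 add0r.
split; first by rewrite (_ : B *m _ = dx) //; apply/esym/eqP; rewrite -subr_eq0; apply/eqP.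
have /matrixP/(_ ord_max 0) := Ey; rewrite y0 !mulmx0 scaler0 subrr !mxE !eqxx mulrN1 => /eqP.
by rewrite eq_sym oppr_eq0 => /eqP q0; rewrite -q0.
Qed.

End Flow.

(** * Passage from monomials to the polynomials [lpoly] *)

Section PolynomialMatrix.
Variables (R : realType) (a b : nat -> R).

Definition lcoef_mx m : 'M[R]_m := \matrix_(i, j) (lpoly a b i)`_j.

Lemma det_lcoef_mx m : \det (lcoef_mx m) = 1.
Proof.
rewrite det_trig; last first.
  apply/is_trig_mxP => i j ij; rewrite mxE nth_default //.
  by have [_ ->] := lpoly_monic_size a b i.
apply: big1 => i _; rewrite mxE.
have [/monicP + si] := lpoly_monic_size a b i.
by rewrite /lead_coef si.
Qed.

Lemma mul_lcoef_mx m p (c : 'I_p -> R) :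
  lcoef_mx m *m (\matrix_(i, j) c j ^+ i) = \matrix_(i, j) (lpoly a b i).[c j].
Proof.
apply/matrixP => i j; rewrite !mxE (@horner_coef_wide _ m).
  by apply: eq_bigr => k _; rewrite !mxE.
by have [_ ->] := lpoly_monic_size a b i.
Qed.

(** The coefficient matrix is unitriangular, so the Vandermonde determinant is unchanged. *)
Lemma det_lpoly_mx m (c : 'I_m -> R) :
  \det (\matrix_(i, j) (lpoly a b i).[c j]) =
  \prod_(i < m) \prod_(j < m | (i < j)%N) (c j - c i).
Proof.
rewrite -mul_lcoef_mx det_mulmx det_lcoef_mx mul1r.
have -> : (\matrix_(i, j) c j ^+ i) = Vandermonde m (\row_j c j).
  by apply/matrixP => i j; rewrite !mxE.
by rewrite det_Vandermonde; under eq_bigr do under eq_bigr do rewrite !mxE.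
Qed.

End PolynomialMatrix.

(** * The eigenvector matrix and the weights *)

Section Weights.
Variables (R : realType) (n : nat) (l : nat -> R).
Local Notation N := n.+1.
Hypothesis l_inj : forall i j, (i < N)%N -> (j < N)%N -> l i = l j -> i = j.

Definition eigmx (a b : nat -> R) : 'M[R]_N := \matrix_(i, j) (lpoly a b i).[l j].

Lemma unitmx_eigmx a b : eigmx a b \in unitmx.
Proof.
rewrite unitmxE unitfE det_lpoly_mx; apply/prodf_neq0 => i _; apply/prodf_neq0 => j ij.
rewrite subr_eq0; apply/negP => /eqP/l_inj ji.
by move: ij; rewrite ji ?ltnn.
Qed.

(* The weights [w_j], defined without left eigenvectors: no nonvanishing of the
   [b_n] is then needed along the flow. *)
Definition residues (a b : nat -> R) : 'cV[R]_N :=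
  invmx (Mmx N b *m eigmx a b) *m delta_mx ord0 0.

Lemma unitmx_Meig a b : Mmx N b *m eigmx a b \in unitmx.
Proof. by rewrite unitmx_mul unitmx_Mmx unitmx_eigmx. Qed.

Lemma mul_residues a b : Mmx N b *m eigmx a b *m residues a b = delta_mx ord0 0.
Proof. by rewrite mulmxA mulmxV ?unitmx_Meig // mul1mx. Qed.

Lemma Lmx_eigmx a b : (forall j, (j < N)%N -> (lpoly a b N).[l j] = 0) ->
  Lmx N a *m eigmx a b = Mmx N b *m eigmx a b *m diag_mx (\row_j l j).
Proof.
move=> rootN; apply/matrixP => i j; rewrite mul_mx_diag [RHS]mxE [(\row_k l k) 0 j]mxE.
have := @lvec_res _ N a b (l j) i; rewrite rootN // oppr0 mul0rn => /eqP.
rewrite subr_eq0 => /eqP E.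
have colE : forall i, eigmx a b i j = lvec N a b (l j) i 0 by move=> k; rewrite !mxE.
have mulE : forall (A : 'M[R]_N), (A *m eigmx a b) i j = (A *m lvec N a b (l j)) i 0.
  by move=> A; rewrite !mxE; apply: eq_bigr => k _; rewrite colE.
by rewrite !mulE E mulrC.
Qed.

End Weights.

(** * Evolution of the weights along the flow *)

Section WeightFlow.
Variables (R : realType) (n : nat) (l : nat -> R) (F : R -> R) (a b : nat -> R -> R).
Local Notation N := n.+1.
Hypothesis l_inj : forall i j, (i < N)%N -> (j < N)%N -> l i = l j -> i = j.
Hypothesis l_gt0 : forall j, (j < N)%N -> 0 < l j.
Hypothesis sol : toda_solution N F a b.
Hypothesis root0 : forall j, (j < N)%N -> (lpoly (a^~ 0) (b^~ 0) N).[l j] = 0.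

Local Notation L s := (Lmx N (a^~ s)).
Local Notation M s := (Mmx N (b^~ s)).
Local Notation V s := (eigmx n l (a^~ s) (b^~ s)).
Local Notation w s := (residues n l (a^~ s) (b^~ s)).

Lemma lpoly_cst z t : (lpoly (a^~ t) (b^~ t) N).[z] = (lpoly (a^~ 0) (b^~ 0) N).[z].
Proof.
apply: (@is_derive_0_is_cst _ (fun s => (lpoly (a^~ s) (b^~ s) N).[z])) => s.
have solE := sol s.
by have [_ ] := @lvec_flow _ n a b s _ _ (@strict_lower_lower _ _ _)
  (@strict_lower_lower _ _ _) (fun i j => (solE i j).1) (fun i j => (solE i j).2) z.
Qed.

Lemma lpoly_root t j : (j < N)%N -> (lpoly (a^~ t) (b^~ t) N).[l j] = 0.
Proof. by move=> jN; rewrite lpoly_cst root0. Qed.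

Local Notation K s := (M s *m V s).
Local Notation FL := (diag_mx (\row_(j < N) F (l j))).

(** From [L V = M V D], with [D] the diagonal matrix of the eigenvalues, one gets the
    diagonalization [L M^-1 = K D K^-1] for [K = M V]. *)
Lemma matfun_LMinv t : matfun F (L t *m invmx (M t)) = K t *m FL *m invmx (K t).
Proof.
apply: matfunE; exists (K t), (\row_(j < N) l j); split.
- exact: unitmx_Meig.
- by move=> j; rewrite mxE l_gt0.
- rewrite -(Lmx_eigmx (@lpoly_root t)); apply: (canLR (mulmxK (unitmx_Mmx _ _))).
  have VK : V t *m (invmx (K t) *m M t) = 1%:M.
    by apply: mulmx1C; rewrite -mulmxA mulVmx // unitmx_Meig.
  by rewrite -!mulmxA VK mulmx1.
- congr (_ *m _ *m _); apply/matrixP => i j.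
  by rewrite !mxE.
Qed.

(** Since [V' = B V], the product rule gives [(A M - M B) V + M B V], and the terms with [B]
    cancel. *)
Lemma Meig_flow (t : R) :
  mx_derive t (fun s => K s) (strict_lower (matfun F (L t *m invmx (M t))) *m K t).
Proof.
have solE := sol t.
set A := strict_lower _; pose B := strict_lower (matfun F (invmx (M t) *m L t)).
have dM : mx_derive t (fun s => M s) (A *m M t - M t *m B) by move=> i j; exact: (solE i j).2.
have dV : mx_derive t (fun s => V s) (B *m V t).
  move=> i j.
  have [dx _] := @lvec_flow _ n a b t A B (@strict_lower_lower _ _ _)
    (@strict_lower_lower _ _ _) (fun i j => (solE i j).1) dM (l j).
  have -> : (B *m V t) i j = (B *m lvec N (a^~ t) (b^~ t) (l j)) i 0.
    by rewrite !mxE; apply: eq_bigr => k _; rewrite !mxE.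
  rewrite (_ : (fun s => V s i j) = fun s => lvec N (a^~ s) (b^~ s) (l j) i 0).
    exact: dx.
  by apply/funext => s; rewrite !mxE.
have := mx_deriveM dM dV.
by rewrite mulmxBl -!mulmxA subrK.
Qed.

(** Let [X = F(L M^-1) = K FL K^-1]. Differentiating [K w = e_1] gives [K w' = - A e_1]. As [A] is
    the strictly lower part of [X], [A e_1 = X e_1 - h e_1] with [h] the top left entry of [X], and
    [X e_1 = K FL w]. *)
Lemma residues_flow (t : R) : exists h : R, forall j : 'I_N,
  is_derive t 1 (fun s => w s j 0) ((h - F (l j)) * w t j 0).
Proof.
set A := strict_lower (matfun F (L t *m invmx (M t))).
have dK := Meig_flow t.
pose e1 : 'cV[R]_N := delta_mx ord0 0.
pose h := (matfun F (L t *m invmx (M t))) ord0 ord0.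
have uK s : K s \in unitmx by exact: unitmx_Meig.
pose dw : 'cV[R]_N := \col_j 'D_1 (fun s => w s j 0) t.
have hw : mx_derive t (fun s => w s) dw.
  move=> i j; rewrite mxE (ord1 j); apply: derivableP.
  under eq_fun do rewrite mxE.
  apply: derivable_bigsum => k _; apply: derivable_mulf; last exact: derivable_cst.
  by apply: mx_derivable_invmx uK i k => i' j'; have [] := dK i' j'.
have := mx_deriveM dK hw.
under [X in mx_derive _ X]eq_fun do rewrite mul_residues //.
move=> /mx_derive_unique /(_ (mx_derive_cst _ _)).
rewrite -mulmxA mul_residues // -/A -/e1 => E.
have AE : A *m e1 = matfun F (L t *m invmx (M t)) *m e1 - h *: e1.
  apply/matrixP => i j; rewrite (ord1 j) -!colE !mxE eqxx andbT.
  case: (posnP i) => [i0|i0]; last first.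
    by rewrite -val_eqE /= (gtn_eqF i0) mulr0 subr0.
  have -> : i = ord0 by apply/val_inj.
  by rewrite eqxx mulr1 subrr.
have e1E : e1 = K t *m w t by rewrite mul_residues.
have dwE : dw = h *: w t - FL *m w t.
  apply: (can_inj (mulKmx (uK t))).
  rewrite mulmxBr -scalemxAr -e1E.
  move: E => /eqP; rewrite addrC addr_eq0 => /eqP ->.
  rewrite AE matfun_LMinv opprB; congr (_ - _).
  by rewrite [in LHS]e1E -[LHS]mulmxA mulKmx // -[LHS]mulmxA.
exists h => j; have := hw j 0; rewrite dwE mul_diag_mx !mxE.
by rewrite mulrBl.
Qed.

(** All functions [f j] satisfy [f' = h f] with the same [h]. Instead of integrating [h], one checks
    that the quotients [f i * f j / S] have derivative 0, which makes the vector of the [f j] at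
    time [t] proportional to the one at time 0. *)
Lemma residues_evolution : exists2 rho : R -> R, (forall t, rho t != 0) &
  forall t (j : 'I_N), w t j 0 = rho t * (w 0 j 0 * expR (- (t * F (l j)))).
Proof.
pose f j s := w s j 0 * expR (s * F (l j)).
have fflow (t : R) : exists h : R, forall j : 'I_N, is_derive t 1 (f j) (h * f j t).
  have [h hw] := residues_flow t; exists h => j.
  have dexp : is_derive t 1 (fun s => expR (s * F (l j))) (F (l j) * expR (t * F (l j))).
    rewrite mulrC; apply: (@is_derive1_comp _ expR (fun s => s * F (l j))).
    under eq_fun do rewrite mulrC.
    apply: (is_derive_eq (is_deriveZ (F (l j)) (is_derive_id t 1))).
    exact: mulr1.
  apply: (is_derive_eq (is_derive_mulf (hw j) dexp)).
  by rewrite /f; ring.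
(* A denominator of degree 2 that never vanishes, because [w] is never the zero vector; no single
   [f j] is known to be nonzero yet. *)
pose S s := \sum_(j < N) f j s ^+ 2.
have w_neq0 (t : R) : exists j : 'I_N, w t j 0 != 0.
  apply/existsP; rewrite -negb_forall; apply/negP => /forallP w0.
  have : (w t : 'cV[R]_N) = 0 by apply/matrixP => i j; rewrite (ord1 j) (eqP (w0 i)) mxE.
  move=> w00; have := @mul_residues _ _ _ l_inj (a^~ t) (b^~ t).
  rewrite w00 mulmx0 => /matrixP/(_ ord0 0); rewrite !mxE !eqxx => /eqP.
  by rewrite eq_sym oner_eq0.
have S_gt0 (t : R) : 0 < S t.
  have [j wj] := w_neq0 t.
  rewrite lt_neqAle sumr_ge0 ?andbT => [|i _]; last exact: sqr_ge0.
  rewrite eq_sym psumr_neq0 => [|i _]; last exact: sqr_ge0.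
  apply/hasP; exists j; first by rewrite mem_index_enum.
  by rewrite /= exprn_even_gt0 //= mulf_neq0 // gt_eqF ?expR_gt0.
have ratio_cst i j (t : R) : f i t * f j t / S t = f i 0 * f j 0 / S 0.
  apply: (@is_derive_0_is_cst _ (fun s => f i s * f j s / S s)) => {}t.
  have [h hf] := fflow t.
  have dS : is_derive t 1 S (\sum_(j < N) (h * f j t * f j t + f j t * (h * f j t))).
    rewrite /S; under eq_fun do under eq_bigr do rewrite expr2.
    by apply: is_derive_bigsum => k; exact: is_derive_mulf.
  have dSV := is_deriveV (lt0r_neq0 (S_gt0 t)) dS.
  apply: (is_derive_eq (is_derive_mulf (is_derive_mulf (hf i) (hf j)) dSV)).
  rewrite /= (_ : \sum_(j < N) _ = 2 * h * S t); last first.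
    by rewrite /S mulr_sumr; apply: eq_bigr => k _; ring.
  rewrite /GRing.scale /=; field; exact: lt0r_neq0.
have [i0 wi0] := w_neq0 0.
(* Constancy of [f i0 ^+ 2 / S] carries nonvanishing from time 0 to every [t]. *)
have fi0 (t : R) : f i0 t != 0.
  apply/negP => /eqP f0; have := ratio_cst i0 i0 t; rewrite f0 !mul0r => /eqP.
  rewrite eq_sym mulf_eq0 invr_eq0 (gt_eqF (S_gt0 0)) orbF mulf_eq0 orbb.
  by rewrite /f mul0r expR0 mulr1 (negbTE wi0).
exists (fun t => f i0 t / f i0 0); first by move=> t; rewrite mulf_neq0 ?invr_eq0.
move=> t j.
(* Comparing the constant quotients for [(j, i0)] and [(i0, i0)] eliminates [S]. *)
have fE : f j t * f i0 0 = f i0 t * f j 0.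
  apply: (mulfI (fi0 t)); apply: (mulfI (fi0 0)).
  have := ratio_cst j i0 t; have := ratio_cst i0 i0 t.
  move: (S t) (S 0) (S_gt0 t) (S_gt0 0) => St S0 St0 S00 E1 E2.
  have cross x y : x / St = y / S0 -> x * S0 = y * St.
    by move=> xy; apply/eqP; rewrite -eqr_div ?lt0r_neq0 // xy.
  move: E1 E2 => /cross E1 /cross E2.
  apply: (mulfI (lt0r_neq0 S00)).
  have -> : S0 * (f i0 0 * (f i0 t * (f j t * f i0 0))) =
    f i0 0 * f i0 0 * (f j t * f i0 t * S0) by ring.
  have -> : S0 * (f i0 0 * (f i0 t * (f i0 t * f j 0))) =
    f i0 0 * f j 0 * (f i0 t * f i0 t * S0) by ring.
  by rewrite E1 E2; ring.
have fj0 : f j 0 = w 0 j 0 by rewrite /f mul0r expR0 mulr1.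
rewrite -fj0 [RHS]mulrA [f i0 t / _ * _]mulrAC -fE mulfK // /f -mulrA -expRD.
by rewrite subrr expR0 mulr1.
Qed.

End WeightFlow.

(** * Toeplitz determinants at a fixed time *)

Section StaticIdentity.
Variables (R : realType) (n : nat) (l : nat -> R) (a b : nat -> R).
Local Notation N := n.+1.
Hypothesis l_inj : forall i j, (i < N)%N -> (j < N)%N -> l i = l j -> i = j.
Hypothesis l_neq0 : forall j, (j < N)%N -> l j != 0.
Hypothesis root : forall j, (j < N)%N -> (lpoly a b N).[l j] = 0.
Hypothesis a_neq0 : forall i, (i < N)%N -> a i.+1 != 0.

Local Notation L := (Lmx N a).
Local Notation M := (Mmx N b).
Local Notation V := (eigmx n l a b).
Local Notation w := (residues n l a b).

Let om j := w (inord j) 0.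

(* [h k] is [M^-1 (L M^-1)^-k e_1]. *)
Let h k : 'cV[R]_N := V *m \col_(j < N) ((l j) ^- k * om j).
Let g k := M *m h k.

Let g0 : g 0 = delta_mx ord0 0.
Proof.
rewrite /g /h mulmxA -[RHS](mul_residues l_inj a b); congr (_ *m _).
by apply/matrixP => i j; rewrite (ord1 j) mxE invr1 mul1r /om inord_val.
Qed.

Let L_h k : L *m h k.+1 = g k.
Proof.
rewrite /g /h !mulmxA Lmx_eigmx // -mulmxA; congr (_ *m _).
apply/matrixP => i j; rewrite mul_diag_mx !mxE exprS invfM -!mulrA mulrCA.
by rewrite mulrA mulVf ?l_neq0 // mul1r.
Qed.

(** This will be entry [k] of [g k], the lowest one that can be nonzero. *)
Let gam k := \prod_(i < k) (- b i.+1 / a i.+1).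

(** Back substitution in [L h_(k+1) = g_k], from the last row upward: inverting an upper bidiagonal
    matrix does not extend the support downward. *)
Let h_support k :
  (forall i : 'I_N, (k < i)%N -> g k i 0 = 0) ->
  (forall i : 'I_N, (k < i)%N -> h k.+1 i 0 = 0).
Proof.
move=> g_gt i.
have [m] := ubnP (N - i); elim: m i => // m IH i im ki.
have := congr1 (fun x : 'cV_N => x i 0) (L_h k); rewrite g_gt //.
have [iN|iN] := eqVneq i.+1 N.
  by rewrite mul_Lmx_last // => /eqP; rewrite mulf_eq0 (negbTE (a_neq0 _)) // => /eqP.
have iN' : (i.+1 < N)%N by rewrite ltn_neqAle iN ltn_ord.
rewrite (@mul_Lmx_lt _ _ _ _ _ _ (Ordinal iN')) //.
rewrite (IH (Ordinal iN')) /= ?addr0; [|by lia|by lia].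
by move=> /eqP; rewrite mulf_eq0 (negbTE (a_neq0 _)) // => /eqP.
Qed.

Let h_diag (i : 'I_N) : (forall i' : 'I_N, (i < i')%N -> g i i' 0 = 0) ->
  h i.+1 i 0 = g i i 0 / a i.+1.
Proof.
move=> g_gt; have ai : a i.+1 != 0 by exact: a_neq0.
rewrite -L_h.
have [iN|iN] := eqVneq i.+1 N.
  by rewrite mul_Lmx_last // mulrC mulKf.
have iN' : (i.+1 < N)%N by rewrite ltn_neqAle iN ltn_ord.
rewrite (@mul_Lmx_lt _ _ _ _ _ _ (Ordinal iN')) //.
by rewrite (h_support g_gt (i := Ordinal iN')) /= ?ltnSn // addr0 mulrC mulKf.
Qed.

(** Passing from [g k] to [h k.+1] keeps the support; the subdiagonal of [M] then extends it by one
    place, and the new entry gains the factor [- b k.+1 / a k.+1]. *)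
Let g_support k :
  (forall i : 'I_N, (k < i)%N -> g k i 0 = 0) /\
  (forall i : 'I_N, i = k :> nat -> g k i 0 = gam k).
Proof.
elim: k => [|k [g_gt g_eq]].
  rewrite g0 /gam big_ord0; split => i ik; rewrite mxE eqxx andbT -val_eqE /=.
    by rewrite (gtn_eqF ik).
  by rewrite ik.
split=> i ik.
  have i1 : (i.-1 < N)%N by have := ltn_ord i; lia.
  rewrite /g (@mul_MmxS _ _ _ _ _ _ (Ordinal i1)) /=; last by lia.
  by rewrite !(h_support g_gt) /= ?mulr0 ?subrr //; lia.
have kN : (k < N)%N by rewrite ltnW // -ik.
rewrite /g (@mul_MmxS _ _ _ _ _ _ (Ordinal kN)) //=.
rewrite (h_support g_gt) ?ik // (@h_diag (Ordinal kN) g_gt) g_eq // sub0r.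
by rewrite /gam big_ord_recr /= mulrCA mulNr mulrN.
Qed.

(** Entry [(i, k)] is the moment of order [i - k] of the masses [om j] at the nodes [l j]. The two
    powers are kept apart because the matrix factors through them. *)
Definition toeplitz m (om : nat -> R) : 'M[R]_m :=
  \matrix_(i, k) \sum_(j < N) (l j) ^+ i * om j * (l j) ^- k.

(** Multiplication by the coefficient matrix replaces [l j ^+ i] by the value of [lpoly i] at [l j],
    an entry of [V]; column [k] becomes the top part of [h (k + c)]. *)
Let lcoef_toeplitz m c : (m <= N)%N ->
  lcoef_mx a b m *m toeplitz m (fun j => (l j) ^- c * om j) =
  \matrix_(i, k) h (k + c) (inord i) 0.
Proof.
move=> mN.
have -> : toeplitz m (fun j => (l j) ^- c * om j) =
    (\matrix_(i < m, j < N) (l j) ^+ i) *m (\matrix_(j, k) (om j * (l j) ^- (k + c))).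
  apply/matrixP => i k; rewrite !mxE; apply: eq_bigr => j _; rewrite !mxE.
  rewrite exprD invfM; move: (_ ^+ i) (_ ^- c) (_ ^- k) => x y z; ring.
rewrite mulmxA (mul_lcoef_mx a b m (fun j : 'I_N => l j)).
apply/matrixP => i k; rewrite !mxE; apply: eq_bigr => j _; rewrite !mxE.
rewrite inordK ?(leq_trans (ltn_ord i)) //; congr (_ * _).
by rewrite mulrC.
Qed.

Let det_toeplitz_h m c : (m <= N)%N ->
  \det (toeplitz m (fun j => (l j) ^- c * om j)) =
  \det (\matrix_(i < m, k < m) h (k + c) (inord i) 0).
Proof.
by move=> mN; rewrite -lcoef_toeplitz // det_mulmx det_lcoef_mx mul1r.
Qed.

(** The leading block of [M], of determinant 1, turns the columns [h k] into [g k], which form an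
    upper triangular matrix with diagonal [gam]. *)
Lemma det_toeplitz m : (m <= N)%N ->
  \det (toeplitz m (fun j => w (inord j) 0)) = \prod_(k < m) gam k.
Proof.
move=> mN.
have -> : toeplitz m (fun j => w (inord j) 0) = toeplitz m (fun j => (l j) ^- 0 * om j).
  by apply/matrixP => i k; rewrite !mxE; under [RHS]eq_bigr do rewrite invr1 mul1r.
rewrite det_toeplitz_h // -[LHS]mul1r -{1}(det_Mmx m b) -det_mulmx.
have inordS (i : 'I_m) : (inord i : 'I_N) = i :> nat by rewrite inordK // (leq_trans (ltn_ord i)).
(* As [M] is lower triangular, its leading block acts on truncated vectors as [M] does. *)
have -> : Mmx m b *m (\matrix_(i < m, k < m) h (k + 0) (inord i) 0) =
    \matrix_(i < m, k < m) g k (inord i) 0.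
  apply/matrixP => i k; rewrite [RHS]mxE /g.
  case: (posnP i) => [i0|i_gt0].
    by rewrite !mul_Mmx0 ?inordS // mxE addn0.
  have i1 : (i.-1 < m)%N by have := ltn_ord i; lia.
  rewrite (@mul_MmxS _ _ _ _ _ _ (Ordinal i1)) /=; last by lia.
  rewrite (@mul_MmxS _ _ _ _ _ _ (inord i.-1)) /= ?inordS ?(inordS (Ordinal i1)) //=; last by lia.
  by rewrite !mxE addn0.
rewrite -det_tr det_trig.
  apply: eq_bigr => k _; rewrite mxE mxE.
  by have [_ ->] := g_support k.
apply/is_trig_mxP => i j ij; rewrite mxE mxE.
by have [-> //] := g_support i; rewrite inordS.
Qed.

(** Dividing the weights by [l j] shifts [h k] to [h k.+1], and these columns are already upper
    triangular. *)
Lemma det_toeplitz_inv m : (m <= N)%N ->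
  \det (toeplitz m (fun j => (l j)^-1 * w (inord j) 0)) =
  \prod_(k < m) (gam k / a k.+1).
Proof.
move=> mN; rewrite (@det_toeplitz_h m 1) // -det_tr det_trig.
  apply: eq_bigr => k _; rewrite mxE mxE addn1.
  have kN := leq_trans (ltn_ord k) mN.
  have [g_gt g_eq] := g_support k.
  have -> : inord k = Ordinal kN :> 'I_N by apply/val_inj; rewrite /= inordK.
  by rewrite (@h_diag (Ordinal kN) g_gt) /= g_eq.
apply/is_trig_mxP => i j ij; rewrite mxE mxE addn1.
have [g_gt g_eq] := g_support i.
by rewrite (h_support g_gt) // inordK // (leq_trans (ltn_ord j)).
Qed.

(** Going from [H k.+1] to [H k.+2] adds the factor [gam k.+1], from [H' k] to [H' k.+1] the factor
    [gam k / a k.+1]; the first is [- b k.+1] times the second. *)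
Lemma b_toeplitz k : (k.+2 <= N)%N ->
  let H m := \det (toeplitz m (fun j => w (inord j) 0)) in
  let H' m := \det (toeplitz m (fun j => (l j)^-1 * w (inord j) 0)) in
  b k.+1 * (H k.+1 * H' k.+1) = - (H k.+2 * H' k).
Proof.
move=> kN H H'.
have kN1 : (k.+1 <= N)%N by exact: ltnW.
have ak : a k.+1 != 0 by exact: a_neq0.
rewrite {}/H {}/H' (det_toeplitz kN1) (det_toeplitz kN).
rewrite (det_toeplitz_inv kN1) (det_toeplitz_inv (ltnW kN1)).
rewrite [\prod_(i < k.+2) _]big_ord_recr [\prod_(i < k.+1) (_ / _)]big_ord_recr /=.
have -> : gam k.+1 = gam k * (- b k.+1 / a k.+1) by rewrite /gam big_ord_recr.
move: (\prod_(i < k.+1) gam i) (\prod_(i < k) _) (gam k) => x y z.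
by field.
Qed.

End StaticIdentity.

(** * Determinants with exponentially separated weights *)

Section Dominant.
Variable R : realType.

(** The Cauchy-Binet formula before grouping: multilinear expansion in the columns of the product,
    each a combination of columns of [C]. *)
Lemma det_mulmx_sum_ffun m N (C : 'M[R]_(m, N)) (D : 'M[R]_(N, m)) :
  \det (C *m D) =
  \sum_(f : {ffun 'I_m -> 'I_N}) (\prod_k D (f k) k) * \det (colsub f C).
Proof.
rewrite -det_tr trmx_mul {1}/determinant.
transitivity (\sum_(s : {perm 'I_m}) \sum_(f : {ffun 'I_m -> 'I_N})
    (-1) ^+ s * \prod_k (D (f k) k * C (s k) (f k))).
  apply: eq_bigr => s _; rewrite -mulr_sumr -(bigA_distr_bigA (fun k j => D j k * C (s k) j)).
  congr (_ * _); apply: eq_bigr => k _; rewrite mxE; apply: eq_bigr => j _.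
  by rewrite !mxE.
rewrite exchange_big; apply: eq_bigr => f _.
rewrite -[in RHS]det_tr /determinant mulr_sumr.
apply: eq_bigr => s _; rewrite /= big_split mulrCA; congr (_ * (_ * _)).
by apply: eq_bigr => k _; rewrite !mxE.
Qed.

Lemma det_colsub_noninj m N (C : 'M[R]_(m, N)) (f : 'I_m -> 'I_N) :
  ~~ injectiveb f -> \det (colsub f C) = 0.
Proof.
move=> /injectivePn[i [j ij fij]]; rewrite -det_tr.
by apply: (determinant_alternate ij) => k; rewrite !mxE fij.
Qed.

(** After subtraction of the threshold [c = phi m.-1], terms with index below [m] are nonnegative
    and all others negative. By injectivity the left sum runs over the image of [f], and the two
    sums are compared index by index. *)
Lemma sum_lt_top m N (phi : nat -> R) (f : 'I_m -> 'I_N) : (m <= N)%N ->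
  (forall i j, (i < j < N)%N -> phi j < phi i) ->
  injective f -> ~~ [forall k, f k < m]%N ->
  \sum_(k < m) phi (f k) < \sum_(k < m) phi k.
Proof.
move=> mN dphi f_inj /forallPn[k0]; rewrite -leqNgt => mfk0.
have m_gt0 : (0 < m)%N by rewrite (leq_ltn_trans _ (ltn_ord k0)).
pose c := phi m.-1.
suff : \sum_(k < m) (phi (f k) - c) < \sum_(k < m) (phi k - c).
  by rewrite !sumrB ltrD2r.
have -> : \sum_(k < m) (phi (f k) - c) =
    \sum_(j < N) if j \in codom f then phi j - c else 0.
  rewrite -big_mkcond -big_uniq /=; first by rewrite big_image.
  by rewrite map_inj_uniq ?enum_uniq.
rewrite (big_ord_widen _ (fun k => phi k - c) mN) [ltRHS]big_mkcond /=.
have geq_c j : (j < N)%N -> if (j < m)%N then 0 <= phi j - c else phi j - c < 0.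
  move=> jN; case: ltnP => jm; last by rewrite subr_lt0 dphi // jN; lia.
  rewrite subr_ge0; have [->//|jm1] := eqVneq j m.-1.
  by rewrite ltW // dphi //; lia.
(* The term of [f k0] is negative on the left and 0 on the right, which makes the inequality
   strict. *)
rewrite (bigD1 (f k0)) //= [ltRHS](bigD1 (f k0)) //=.
apply: ltr_leD.
  rewrite codom_f; have := geq_c _ (ltn_ord (f k0)).
  have fk0m : (f k0 < m)%N = false by rewrite ltnNge mfk0.
  by rewrite fk0m.

apply: ler_sum => j _; have := geq_c _ (ltn_ord j).
by case: ifP => _; case: ifP => // _; exact: ltW.
Qed.

Lemma cvg_expR_scale (c : R) : c < 0 -> expR (s * c) @[s --> +oo] --> (0 : R).
Proof.
move=> c0; under eq_fun => s do rewrite -[s * c]opprK -mulrN.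
apply: (@cvg_comp _ _ _ (fun s : R => s * - c) (fun x => expR (- x)) _ (pinfty_nbhs R)).
  by apply: gt0_cvgMly; rewrite ?oppr_gt0 //; exact: cvg_id.
exact: cvgr_expR.
Qed.

Lemma cvg_bigsum (T : Type) (G : set_system T) (FG : Filter G) I (r : seq I)
    (h : I -> T -> R) (c : I -> R) :
  (forall i, h i x @[x --> G] --> c i) ->
  \sum_(i <- r) h i x @[x --> G] --> \sum_(i <- r) c i.
Proof. by move=> hc; apply: cvg_big => [|i _]; [exact: add_continuous|exact: hc]. Qed.

Lemma cvg_mulf (T : Type) (G : set_system T) (FG : Filter G) (f g : T -> R) (x y : R) :
  f s @[s --> G] --> x -> g s @[s --> G] --> y -> f s * g s @[s --> G] --> x * y.
Proof. exact: cvgM. Qed.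

(** The term of [f] in the expansion carries [exp(s d)], with [d] the sum of the exponents chosen by
    [f] minus the sum of the [m] largest. For injective [f], [d] is 0 if [f] permutes the first [m]
    indices and negative otherwise. *)
Lemma dominant_minor m N (mN : (m <= N)%N) (phi : nat -> R)
    (C : 'M[R]_(m, N)) (D : 'M[R]_(N, m)) :
  (forall i j, (i < j < N)%N -> phi j < phi i) ->
  expR (s * - \sum_(k < m) phi k) *
    \det (C *m diag_mx (\row_j expR (s * phi j)) *m D) @[s --> +oo] -->
  \det (colsub (widen_ord mN) C) * \det (rowsub (widen_ord mN) D).
Proof.
move=> dphi.
(* Clearing the rows of [D] from [m] on gives the limit the same expansion, so that convergence is
   checked term by term. *)
pose D' : 'M[R]_(N, m) := \matrix_(j, k) if (j < m)%N then D j k else 0.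
have -> : \det (colsub (widen_ord mN) C) * \det (rowsub (widen_ord mN) D) = \det (C *m D').
  rewrite -det_mulmx; congr (\det _); apply/matrixP => i k; rewrite !mxE.
  under eq_bigr do rewrite !mxE.
  rewrite -(@big_ord_narrow _ _ _ m N (fun j : 'I_N => C i j * D j k) mN) big_mkcond /=.
  apply: eq_bigr => j _; rewrite mxE.
  by case: ifP; rewrite ?mulr0.
under eq_fun => s do rewrite -mulmxA det_mulmx_sum_ffun mulr_sumr.
rewrite det_mulmx_sum_ffun; apply: cvg_bigsum => f.
have [f_inj|/det_colsub_noninj C0] := boolP (injectiveb f); last first.
  by under eq_fun => s do rewrite C0 !mulr0; rewrite C0 mulr0; exact: cvg_cst.
under eq_fun => s do rewrite mulrA.
apply: cvg_mulf; last exact: cvg_cst.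
have [d dE] : exists d, d = \sum_(k < m) phi (f k) - \sum_(k < m) phi k by eexists.
have factorE s : expR (s * - \sum_(k < m) phi k) *
    \prod_k (diag_mx (\row_j expR (s * phi j)) *m D) (f k) k =
    expR (s * d) * \prod_k D (f k) k.
  under eq_bigr do rewrite mul_diag_mx !mxE.
  rewrite big_split /= mulrA -expR_sum -expRD -mulr_sumr -mulrDr.
  by rewrite dE addrC.
rewrite (eq_cvg _ _ factorE).
have [/forallP f_lt|f_nlt] := boolP [forall k, f k < m]%N.
  have d0 : d = 0.
    pose f' k := Ordinal (f_lt k).
    have f'_inj : injective f'.
      by move=> i j [] /val_inj /(injectiveP _ f_inj).
    by rewrite dE [X in _ - X](reindex_inj f'_inj) subrr.
  rewrite (_ : (fun s => expR (s * d) * _) = fun=> \prod_k D (f k) k); last first.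
    by apply/funext => s; rewrite d0 mulr0 expR0 mul1r.
  have -> : \prod_k D' (f k) k = \prod_k D (f k) k.
    by apply: eq_bigr => k _; rewrite mxE f_lt.
  exact: cvg_cst.
have d_lt0 : d < 0.
  by rewrite dE subr_lt0; apply: (@sum_lt_top m N) => //; exact/injectiveP.
have -> : \prod_k D' (f k) k = 0 * \prod_k D (f k) k.
  have /forallPn[k0 /negbTE fk0] := f_nlt.
  by rewrite mul0r (bigD1 k0) //= mxE fk0 mul0r.
by apply: cvg_mulf; [exact: cvg_expR_scale|exact: cvg_cst].
Qed.

Definition vdm m (c : nat -> R) := \prod_(i < m) \prod_(j < m | (i < j)%N) (c j - c i).

Lemma vdmS m c : vdm m.+1 c = vdm m c * \prod_(i < m) (c m - c i).
Proof.
rewrite /vdm big_ord_recr /= [X in _ * X]big1 ?mulr1; last first.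
  by move=> j mj; have := ltn_ord j; lia.
rewrite -big_split; apply: eq_bigr => i _ /=.
by rewrite big_mkcond big_ord_recr /= ltn_ord -big_mkcond.
Qed.

Lemma vdm_neq0 m c : (forall i j, (i < m)%N -> (j < m)%N -> c i = c j -> i = j) ->
  vdm m c != 0.
Proof.
move=> c_inj; apply/prodf_neq0 => i _; apply/prodf_neq0 => j ij.
rewrite subr_eq0; apply/negP => /eqP/c_inj ji.
by move: ij; rewrite ji ?ltnn.
Qed.

Lemma cvg_det_toeplitz n m (mN : (m <= n.+1)%N) (phi l om : nat -> R) :
  (forall i j, (i < j < n.+1)%N -> phi j < phi i) ->
  expR (s * - \sum_(k < m) phi k) *
    \det (toeplitz n l m (fun j => om j * expR (s * phi j))) @[s --> +oo] -->
  vdm m l * (\prod_(k < m) om k * vdm m (fun j => (l j)^-1)).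
Proof.
move=> dphi.
pose C : 'M[R]_(m, n.+1) := \matrix_(i, j) l j ^+ i.
pose D : 'M[R]_(n.+1, m) := \matrix_(j, k) (om j * l j ^- k).
have toepE s : toeplitz n l m (fun j => om j * expR (s * phi j)) =
    C *m diag_mx (\row_j expR (s * phi j)) *m D.
  apply/matrixP => i k; rewrite mul_mx_diag !mxE; apply: eq_bigr => j _; rewrite !mxE.
  by rewrite -!mulrA; congr (_ * _); rewrite mulrCA.
under eq_fun => s do rewrite toepE.
have vdmE (c : nat -> R) : \det (Vandermonde m (\row_(j < m) c j)) = vdm m c.
  by rewrite det_Vandermonde; under eq_bigr do under eq_bigr do rewrite !mxE.
have -> : vdm m l = \det (colsub (widen_ord mN) C).
  by rewrite -vdmE; congr (\det _); apply/matrixP => i j; rewrite !mxE.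
have -> : \prod_(k < m) om k * vdm m (fun j => (l j)^-1) = \det (rowsub (widen_ord mN) D).
  rewrite -vdmE -det_tr.
  have -> : \prod_(k < m) om k = \det (diag_mx (\row_(k < m) om k)).
    by rewrite det_diag; apply: eq_bigr => k _; rewrite mxE.
  rewrite -det_mulmx; congr (\det _); apply/matrixP => i j.
  by rewrite mul_diag_mx !mxE exprVn.
exact: dominant_minor.
Qed.

End Dominant.

(** * The limit of the ratio of Toeplitz determinants *)

Section ToeplitzRatio.
Variables (R : realType) (n : nat) (phi l om : nat -> R).
Local Notation N := n.+1.
Hypothesis l_inj : forall i j, (i < N)%N -> (j < N)%N -> l i = l j -> i = j.
Hypothesis l_neq0 : forall j, (j < N)%N -> l j != 0.
Hypothesis om_neq0 : forall j, (j < N)%N -> om j != 0.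
Hypothesis dphi : forall i j, (i < j < N)%N -> phi j < phi i.

Local Notation H m s := (\det (toeplitz n l m (fun j => om j * expR (s * phi j)))).
Local Notation H' m s :=
  (\det (toeplitz n l m (fun j => (l j)^-1 * (om j * expR (s * phi j))))).
Local Notation E m s := (expR (s * - \sum_(k < m) phi k)).

Lemma prod_inv_sub m : (m < N)%N ->
  \prod_(i < m) ((l m)^-1 - (l i)^-1) =
  (-1) ^+ m * \prod_(i < m) (l m - l i) / (l m ^+ m * \prod_(i < m) l i).
Proof.
move=> mN.
have -> : (-1) ^+ m * \prod_(i < m) (l m - l i) = \prod_(i < m) (- (l m - l i)).
  by rewrite prodrN card_ord.
have -> : l m ^+ m = \prod_(i < m) l m by rewrite prodr_const card_ord.
rewrite -big_split /= -prodf_div.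
apply: eq_bigr => i _; have := l_neq0 mN; have := l_neq0 (ltn_trans (ltn_ord i) mN) => li lm.
by field; rewrite li lm.
Qed.

(** The exponents [phi] stay abstract so that one statement serves both ends of time. Each
    determinant is normalized by its own exponential [E], and the limits are products of Vandermonde
    determinants. *)
Lemma toeplitz_ratio_cvg (beta : R -> R) p : (p.+2 <= N)%N ->
  (forall s, beta s * (H p.+1 s * H' p.+1 s) = - (H p.+2 s * H' p s)) ->
  beta s / (om p.+1 / om p * (l p ^+ p / l p.+1 ^+ p.+1) *
    ((\prod_(i < p.+1) (l p.+1 - l i)) / (\prod_(i < p) (l p - l i))) ^+ 2 *
    expR (s * (phi p.+1 - phi p))) @[s --> +oo] --> (1 : R).
Proof.
move=> pN betaE; set c := (_ * _ ^+ 2).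
have p1N : (p.+1 <= N)%N by exact: ltnW.
have p0N : (p <= N)%N by exact: ltnW.
have l'_inj i j : (i < N)%N -> (j < N)%N -> (l i)^-1 = (l j)^-1 -> i = j.
  by move=> iN jN /invr_inj; exact: l_inj.
have om'_neq0 j : (j < N)%N -> (l j)^-1 * om j != 0.
  by move=> jN; rewrite mulf_neq0 ?invr_eq0 ?l_neq0 ?om_neq0.
have cvgH m (mN : (m <= N)%N) := cvg_det_toeplitz mN (l := l) (om := om) dphi.
have cvgH' m (mN : (m <= N)%N) :=
  cvg_det_toeplitz mN (l := l) (om := fun j => (l j)^-1 * om j) dphi.
pose lim m o := vdm m l * (\prod_(k < m) o k * vdm m (fun j => (l j)^-1)).
have lim_neq0 m o : (m <= N)%N -> (forall j, (j < N)%N -> o j != 0) -> lim m o != 0.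
  move=> mN o0; have ltN i : (i < m)%N -> (i < N)%N by move=> im; exact: leq_trans mN.
  rewrite !mulf_neq0 ?vdm_neq0 //.
  - by move=> i j im jm; apply: l_inj; exact: ltN.
  - by apply/prodf_neq0 => k _; apply/o0/ltN.
  - by move=> i j im jm; apply: l'_inj; exact: ltN.
have H'E m s : H' m s =
    \det (toeplitz n l m (fun j => (l j)^-1 * om j * expR (s * phi j))).
  congr (\det _); apply/matrixP => i k; rewrite !mxE.
  by under eq_bigr do rewrite [X in _ * X * _]mulrA.
pose den s := (E p.+1 s * H p.+1 s) * (E p.+1 s * H' p.+1 s).
pose num s := (E p.+2 s * H p.+2 s) * (E p s * H' p s).
pose om' j := (l j)^-1 * om j.
have den_cvg : den s @[s --> +oo] --> lim p.+1 om * lim p.+1 om'.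
  rewrite /den; under eq_fun => s do rewrite H'E.
  by apply: cvg_mulf; [exact: cvgH|exact: cvgH'].
have num_cvg : num s @[s --> +oo] --> lim p.+2 om * lim p om'.
  rewrite /num; under eq_fun => s do rewrite H'E.
  by apply: cvg_mulf; [exact: cvgH|exact: cvgH'].
have dlim_neq0 : lim p.+1 om * lim p.+1 om' != 0 by rewrite mulf_neq0 ?lim_neq0.
(* The Vandermonde determinants in [l] leave one quotient of products; those in the inverses leave a
   second copy, which gives the square, together with the powers of [l] and a sign that cancels the
   minus. *)
have limE : - (lim p.+2 om * lim p om') / (lim p.+1 om * lim p.+1 om') = c.
  have omE m : \prod_(k < m) om' k = \prod_(k < m) om k / \prod_(k < m) l k.
    by rewrite -prodf_div; apply: eq_bigr => k _; rewrite mulrC.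
  rewrite /lim !omE ![vdm _.+1 _]vdmS !(prod_inv_sub p1N, prod_inv_sub pN).
  rewrite /c [\prod_(k < p.+2) om k]big_ord_recr ![\prod_(k < p.+1) om k]big_ord_recr.
  rewrite ![\prod_(k < p.+1) l k]big_ord_recr /=.
  have ltN i : (i < p)%N -> (i < N)%N by move=> ip; rewrite (leq_trans ip).
  have : \prod_(i < p) om i != 0 by apply/prodf_neq0 => k _; apply/om_neq0/ltN.
  have : \prod_(i < p) l i != 0 by apply/prodf_neq0 => k _; apply/l_neq0/ltN.
  have : vdm p l != 0 by apply: vdm_neq0 => i j /ltN ip /ltN jp; exact: l_inj.
  have : vdm p (fun j => (l j)^-1) != 0.
    by apply: vdm_neq0 => i j /ltN ip /ltN jp; exact: l'_inj.
  have : \prod_(i < p) (l p - l i) != 0.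
    apply/prodf_neq0 => k _; rewrite subr_eq0; apply/eqP.
    by move=> /(l_inj p1N (ltN _ (ltn_ord k))) pk; have := ltn_ord k; rewrite -pk ltnn.
  have : \prod_(i < p.+1) (l p.+1 - l i) != 0.
    apply/prodf_neq0 => k _; rewrite subr_eq0; apply/eqP.
    move=> /(l_inj pN (leq_trans (ltn_ord k) p1N)) pk.
    by have := ltn_ord k; rewrite -pk ltnn.
  have : (-1) ^+ p != 0 :> R by rewrite expf_neq0 // oppr_eq0 oner_eq0.
  have : l p ^+ p != 0 by rewrite expf_neq0 // l_neq0.
  have : l p.+1 ^+ p.+1 != 0 by rewrite expf_neq0 // l_neq0.
  have := l_neq0 p1N; have := om_neq0 p1N; have := om_neq0 pN.
  rewrite [(-1) ^+ p.+1]exprS.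
  move: (l p.+1 ^+ p.+1) (l p ^+ p) ((-1) ^+ p) (\prod_(i < p.+1) (l p.+1 - l i)).
  move: (\prod_(i < p) (l p - l i)) (vdm p _) (vdm p l) (\prod_(i < p) l i).
  move: (\prod_(i < p) om i) (l p) (om p) (om p.+1) => o lp op op1 q v v' a b' e x y.
  move=> h1 h2 h3 h4 h5 h6 h7 h8 h9 h10 h11 h12.
  field.
  by do ?[apply/andP; split].
have c_neq0 : c != 0.
  by rewrite -limE mulf_neq0 ?invr_eq0 // oppr_eq0 mulf_neq0 ?lim_neq0.
have ratio_cvg : c^-1 * (- num s / den s) @[s --> +oo] --> (1 : R).
  have -> : 1 = c^-1 * (- (lim p.+2 om * lim p om') / (lim p.+1 om * lim p.+1 om')).
    by rewrite limE mulVf.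
  apply: cvg_mulf; first exact: cvg_cst.
  by apply: cvg_mulf; [exact: cvgN|exact: cvgV].
apply: cvg_trans ratio_cvg; apply: near_eq_cvg.
have den_near : \forall s \near +oo, den s != 0 by exact: cvgr_neq0 den_cvg dlim_neq0.
apply: filterS den_near => s den0.
(* The exponents form a second difference of the partial sums of [phi]. *)
have EE : E p.+2 s * E p s = expR (- (s * (phi p.+1 - phi p))) * (E p.+1 s * E p.+1 s).
  by rewrite -!expRD; congr expR; rewrite !big_ord_recr /=; ring.
have numE : - num s = beta s * expR (- (s * (phi p.+1 - phi p))) * den s.
  transitivity (E p.+2 s * E p s * - (H p.+2 s * H' p s)); first by rewrite /num; ring.
  by rewrite EE -betaE /den; ring.
by rewrite numE mulfK // [(c * _)^-1]invfM expRN mulrCA.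
Qed.

End ToeplitzRatio.

(** * Asymptotic equivalence, index reversal and rescaling *)

Lemma asymptotic_equiv (R : realType) (G : set_system R) (FG : Filter G) (f g : R -> R) :
  f t / g t @[t --> G] --> (1 : R) ->
  exists2 e : R -> R, e t @[t --> G] --> (0 : R) & \forall t \near G, f t = g t * (1 + e t).
Proof.
move=> fg; exists (fun t => f t / g t - 1).
  by rewrite -(subrr 1); apply: cvgB => //; exact: cvg_cst.
(* Since [x / 0 = 0], a nonzero quotient has a nonzero denominator. *)
have fg0 : \forall t \near G, f t / g t != 0 by exact: cvgr_neq0 fg (oner_neq0 R).
apply: filterS fg0 => t; rewrite mulf_eq0 invr_eq0 negb_or => /andP[_ g0].
by rewrite addrC subrK mulrC divfK.
Qed.

Lemma prod_nat_sub (R : realType) (G : nat -> R) N k : (k <= N)%N ->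
  \prod_((N - k).+1 <= i < N.+1) G i = \prod_(i < k) G (N - i)%N.
Proof.
elim: k => [|k IH] kN; first by rewrite subn0 big_geq // big_ord0.
by rewrite big_ord_recr /= -(IH (ltnW kN)) subnSK // big_ltn ?ltnS ?leq_subr // mulrC.
Qed.

Lemma toeplitz_rev (R : realType) n (l om : nat -> R) m :
  toeplitz n (fun j => l (n - j)%N) m (fun j => om (n - j)%N) = toeplitz n l m om.
Proof.
apply/matrixP => i k; rewrite !mxE [RHS](reindex_inj rev_ord_inj) /=.
by apply: eq_bigr => j _; rewrite subSS.
Qed.

Lemma toeplitzZ (R : realType) n (l om om' : nat -> R) c m :
  (forall j, (j < n.+1)%N -> om j = c * om' j) ->
  toeplitz n l m om = c *: toeplitz n l m om'.
Proof.
move=> omE; apply/matrixP => i k; rewrite !mxE mulr_sumr; apply: eq_bigr => j _.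
by rewrite omE // !mulrA [_ * c]mulrC.
Qed.

(** * The solution in terms of the initial weights *)

Section TodaToeplitz.
Variables (R : realType) (n : nat) (F : R -> R) (a b : nat -> R -> R) (l om : nat -> R).
Variables (u v : nat -> 'cV[R]_n.+1).
Local Notation N := n.+1.
Local Notation L0 := (Lmx N (a^~ 0)).
Local Notation M0 := (Mmx N (b^~ 0)).
Hypothesis l_inj : forall i j, (i < N)%N -> (j < N)%N -> l i = l j -> i = j.
Hypothesis l_gt0 : forall j, (j < N)%N -> 0 < l j.
Hypothesis sol : toda_solution N F a b.
Hypothesis a0_neq0 : forall i, (i < N)%N -> a i.+1 0 != 0.
Hypothesis vP : forall j, (j < N)%N -> right_eigvec L0 M0 (l j) (v j).
Hypothesis uP : forall j, (j < N)%N -> left_eigvec L0 M0 (l j) (u j).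
Hypothesis omE : forall j, (j < N)%N -> om j = weight M0 (u j) (v j).

Lemma right_eigvecE j : (j < N)%N -> v j = lvec N (a^~ 0) (b^~ 0) (l j).
Proof.
move=> jN; have [Lv v1] := vP jN.
rewrite (@eig_lvec _ _ (a^~ 0) (b^~ 0) (l j) (v j) ord0) ?v1 ?scale1r //.
by move=> i _; rewrite Lv mxE.
Qed.

Lemma eigenvalue_root j : (j < N)%N -> (lpoly (a^~ 0) (b^~ 0) N).[l j] = 0.
Proof.
move=> jN; have [Lv _] := vP jN.
have := @lvec_res _ N (a^~ 0) (b^~ 0) (l j) ord_max.
rewrite -right_eigvecE // Lv mxE subrr eqxx mulr1n => /eqP.
by rewrite eq_sym oppr_eq0 => /eqP.
Qed.

(** The value of [lpoly N] at 0 is, up to sign, the product of all [a k], and it is conserved. *)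
Lemma a_neq0 t i : (i < N)%N -> a i.+1 t != 0.
Proof.
move=> iN; have := lpoly_cst sol 0 t; rewrite !lpoly_horner0 => E.
have : \prod_(1 <= k < N.+1) - a k t != 0.
  rewrite E big_add1 big_mkord; apply/prodf_neq0 => k _.
  by rewrite oppr_eq0 a0_neq0.
rewrite big_add1 big_mkord => /prodf_neq0/(_ (Ordinal iN) isT).
by rewrite oppr_eq0.
Qed.

(** Left and right eigenvectors for distinct eigenvalues are orthogonal with respect to [M].
    Applying [u_j^T], of first component 1, to [M V r = e_1] thus leaves [(u_j^T M v_j) r_j = 1]. *)
Lemma weight_residue (j : 'I_N) :
  om j * (((u j)^T *m M0 *m v j) 0 0) = 1 /\ residues n l (a^~ 0) (b^~ 0) j 0 = om j.
Proof.
have [uL u1] := uP (ltn_ord j).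
have := mul_residues l_inj (a^~ 0) (b^~ 0).
move: (residues _ _ _ _) => r rE.
have row0 (k : 'I_N) : k != j -> ((u j)^T *m M0 *m v k) 0 0 = 0.
  move=> kj; have [Lv _] := vP (ltn_ord k).
  have E : l j * ((u j)^T *m M0 *m v k) 0 0 = l k * ((u j)^T *m M0 *m v k) 0 0.
    transitivity (((u j)^T *m L0 *m v k) 0 0).
      by rewrite uL -scalemxAl [RHS]mxE.
    by rewrite -mulmxA Lv -scalemxAr mulmxA [LHS]mxE.
  apply/eqP; move/eqP: E; rewrite -subr_eq0 -mulrBl mulf_eq0 subr_eq0.
  case/orP => // /eqP/l_inj jk; move: kj.
  by rewrite -val_eqE /= jk ?eqxx.
have mulE : ((u j)^T *m M0 *m v j) 0 0 * r j 0 = 1.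
  have := congr1 (fun x : 'cV_N => ((u j)^T *m x) 0 0) rE.
  rewrite /= -colE [RHS]mxE [RHS]mxE u1 // => <-.
  rewrite !mulmxA [RHS]mxE (bigD1 j) //= big1 ?addr0.
    congr (_ * _); rewrite right_eigvecE // [LHS]mxE [RHS]mxE.
    by apply: eq_bigr => k _; rewrite !mxE.
  move=> k kj; rewrite (_ : (_ *m eigmx _ _ _ _) 0 k = 0) ?mul0r //.
  transitivity (((u j)^T *m M0 *m v k) 0 0); last exact: row0.
  rewrite right_eigvecE // [LHS]mxE [RHS]mxE.
  by apply: eq_bigr => i _; rewrite !mxE.
have c0 : ((u j)^T *m M0 *m v j) 0 0 != 0.
  by apply/eqP => c0; move/eqP: mulE; rewrite c0 mul0r eq_sym oner_eq0.
rewrite omE // /weight mulVf //; split=> //.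
by apply: (mulfI c0); rewrite mulE mulfV.
Qed.

Lemma weight_neq0 j : (j < N)%N -> om j != 0.
Proof.
move=> jN; have [+ _] := weight_residue (Ordinal jN).
by move=> /= /eqP; apply: contraTneq => ->; rewrite mul0r eq_sym oner_eq0.
Qed.

Lemma toda_toeplitz p t : (p.+2 <= N)%N ->
  let H m := \det (toeplitz n l m (fun j => om j * expR (t * - F (l j)))) in
  let H' m := \det (toeplitz n l m (fun j => (l j)^-1 * (om j * expR (t * - F (l j))))) in
  b p.+1 t * (H p.+1 * H' p.+1) = - (H p.+2 * H' p).
Proof.
move=> pN H H'.
have [rho rho0 wE] := residues_evolution l_inj l_gt0 sol eigenvalue_root.
pose W j := residues n l (a^~ t) (b^~ t) (inord j) 0.
have WE j : (j < N)%N -> W j = rho t * (om j * expR (t * - F (l j))).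
  move=> jN; rewrite /W wE mulrN.
  have -> : inord j = Ordinal jN :> 'I_N by apply/val_inj; rewrite /= inordK.
  by have [_ ->] := weight_residue (Ordinal jN).
have HE m : \det (toeplitz n l m W) = rho t ^+ m * H m.
  by rewrite (toeplitzZ l m WE) detZ.
have H'E m : \det (toeplitz n l m (fun j => (l j)^-1 * W j)) = rho t ^+ m * H' m.
  rewrite -detZ; congr (\det _); apply: toeplitzZ => j jN.
  by rewrite WE // mulrCA.
have l_neq0 j : (j < N)%N -> l j != 0 by move=> jN; rewrite gt_eqF ?l_gt0.
have := @b_toeplitz _ _ _ _ _ l_inj l_neq0
  (fun j => lpoly_root sol eigenvalue_root t (j := j)) (a_neq0 t) _ pN.
rewrite /= !HE !H'E => E.
(* Both sides have degree [2 p + 2] in the weights, so the same power of [rho t] cancels. *)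
apply: (mulfI (expf_neq0 (p.+1 + p.+1) (rho0 t))).
rewrite exprD; move: E; rewrite [rho t ^+ p.+2]exprS [rho t ^+ p.+1]exprS.
move=> E.
transitivity (b p.+1 t * (rho t * rho t ^+ p * H p.+1 * (rho t * rho t ^+ p * H' p.+1))).
  ring.
by rewrite E; ring.
Qed.

End TodaToeplitz.

(** * The asymptotics at both ends of time *)

Theorem theorem4p3 (R : realType) (N : nat) (F : R -> R)
    (a b : nat -> R -> R) (lam w : nat -> R) (u v : nat -> 'cV[R]_N)
    (F_incr : forall x y : R, 0 < x -> x < y -> F x < F y)
    (sol : toda_solution N F a b)
    (a0_gt0 : forall n, (1 <= n <= N)%N -> 0 < a n 0)
    (b0_gt0 : forall n, (1 <= n < N)%N -> 0 < b n 0)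
    (lamP : gen_eigenvalues (Lmx N (fun n => a n 0)) (Mmx N (fun n => b n 0)) lam)
    (vP : forall j, (1 <= j <= N)%N ->
       right_eigvec (Lmx N (fun n => a n 0)) (Mmx N (fun n => b n 0)) (lam j) (v j))
    (uP : forall j, (1 <= j <= N)%N ->
       left_eigvec (Lmx N (fun n => a n 0)) (Mmx N (fun n => b n 0)) (lam j) (u j))
    (wE : forall j, (1 <= j <= N)%N ->
       w j = weight (Mmx N (fun n => b n 0)) (u j) (v j))
    (n : nat) (hn : (1 <= n < N)%N) :
  (exists2 e : R -> R, e t @[t --> +oo] --> 0 &
     \forall t \near +oo,
       b n t = w n.+1 / w n * (lam n ^+ n.-1 / lam n.+1 ^+ n) *
         ((\prod_(1 <= i < n.+1) (lam n.+1 - lam i)) /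
          (\prod_(1 <= i < n) (lam n - lam i))) ^+ 2 *
         expR (- (t * (F (lam n.+1) - F (lam n)))) * (1 + e t)) /\
  (exists2 e : R -> R, e t @[t --> -oo] --> 0 &
     \forall t \near -oo,
       b n t = (w (N - n)%N * lam (N - n).+1 ^+ n.-1) /
               (w (N - n).+1 * lam (N - n)%N ^+ n) *
         ((\prod_((N - n).+1 <= i < N.+1) (lam (N - n)%N - lam i)) /
          (\prod_((N - n).+2 <= i < N.+1) (lam (N - n).+1 - lam i))) ^+ 2 *
         expR (t * (F (lam (N - n).+1) - F (lam (N - n)%N))) * (1 + e t)).
Proof.
case: N u v sol a0_gt0 b0_gt0 lamP vP uP wE hn => [|m] u' v' sol' a0_gt0' _ lamP' vP' uP' wE' hn.
  by lia.
case: n hn => [//|p] hn; have pm : (p.+2 <= m.+1)%N by lia.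
have [lam_gt0 lam_lt _] := lamP'.
have lam_mono i j : (1 <= i)%N -> (i < j <= m.+1)%N -> lam i < lam j.
  move=> i1; elim: j => [|j IH]; first by lia.
  rewrite ltnS => /andP[ij jm]; have jlt : lam j < lam j.+1 by apply: lam_lt; lia.
  have [->//|ij'] := eqVneq i j.
  by apply: lt_trans jlt; apply: IH; lia.
have F_mono i j : (1 <= i)%N -> (i < j <= m.+1)%N -> F (lam i) < F (lam j).
  by move=> i1 ij; apply: F_incr; [apply: lam_gt0; lia|exact: lam_mono].
have lam_inj i j : (1 <= i <= m.+1)%N -> (1 <= j <= m.+1)%N -> lam i = lam j -> i = j.
  move=> hi hj eij; case: (ltngtP i j) => // ij.
    by have := lam_mono i j; rewrite eij ltxx; lia.
  by have := lam_mono j i; rewrite eij ltxx; lia.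
pose l j := lam j.+1; pose om j := w j.+1.
pose u0 j := u' j.+1; pose v0 j := v' j.+1.
have l_inj i j : (i < m.+1)%N -> (j < m.+1)%N -> l i = l j -> i = j.
  by move=> im jm /lam_inj H; apply: succn_inj; apply: H; lia.
have l_gt0 j : (j < m.+1)%N -> 0 < l j by move=> jm; apply: lam_gt0; lia.
have l_neq0 j : (j < m.+1)%N -> l j != 0 by move=> jm; rewrite gt_eqF ?l_gt0.
have a0 i : (i < m.+1)%N -> a i.+1 0 != 0 by move=> im; rewrite gt_eqF // a0_gt0'; lia.
have vP j (jm : (j < m.+1)%N) : right_eigvec _ _ (l j) (v0 j) := vP' j.+1 jm.
have uP j (jm : (j < m.+1)%N) : left_eigvec _ _ (l j) (u0 j) := uP' j.+1 jm.
have omE j (jm : (j < m.+1)%N) : om j = weight _ (u0 j) (v0 j) := wE' j.+1 jm.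
have om_neq0 j := weight_neq0 l_inj vP uP omE (j := j).
have toeplitzE t := toda_toeplitz l_inj l_gt0 sol' a0 vP uP omE t pm.
split.
  (* As [t] tends to [+oo] the smallest eigenvalues dominate: the exponents are [- F (l j)]. *)
  have dphi i j : (i < j < m.+1)%N -> - F (l j) < - F (l i).
    by move=> ij; rewrite ltrN2; apply: F_mono; lia.
  have := toeplitz_ratio_cvg l_inj l_neq0 om_neq0 dphi pm toeplitzE.
  move=> /asymptotic_equiv[e e0 eE]; exists e => //; apply: filterS eE => t ->.
  by rewrite !big_add1 !big_mkord /= -opprD mulrN.
(* For [-oo] the eigenvalues are listed from the largest down and time is reversed: with [s = - t]
   the exponents [F (l' j)] decrease in [j]. *)
pose l' j := lam (m.+1 - j)%N; pose om' j := w (m.+1 - j)%N.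
have revE j : (j < m.+1)%N -> l' j = l (m - j)%N /\ om' j = om (m - j)%N.
  by move=> jm; rewrite /l' /om' /l /om subSn.
have l'_inj i j : (i < m.+1)%N -> (j < m.+1)%N -> l' i = l' j -> i = j.
  by move=> im jm; rewrite (revE i im).1 (revE j jm).1 => /l_inj; lia.
have l'_neq0 j : (j < m.+1)%N -> l' j != 0.
  by move=> jm; rewrite (revE j jm).1 l_neq0 // ltnS leq_subr.
have om'_neq0 j : (j < m.+1)%N -> om' j != 0.
  by move=> jm; rewrite (revE j jm).2 om_neq0 // ltnS leq_subr.
have dphi i j : (i < j < m.+1)%N -> F (l' j) < F (l' i).
  by move=> ij; apply: F_mono; lia.
have toeplitz_revE k (o o' : nat -> R) : (forall j, (j < m.+1)%N -> o' j = o (m - j)%N) ->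
    toeplitz m l' k o' = toeplitz m l k o.
  move=> oE; rewrite -(toeplitz_rev m l o); apply/matrixP => i j; rewrite !mxE.
  by apply: eq_bigr => c _; rewrite (revE c (ltn_ord c)).1 oE.
have toeplitzNE s : b p.+1 (- s) *
    (\det (toeplitz m l' p.+1 (fun j => om' j * expR (s * F (l' j)))) *
     \det (toeplitz m l' p.+1 (fun j => (l' j)^-1 * (om' j * expR (s * F (l' j)))))) =
  - (\det (toeplitz m l' p.+2 (fun j => om' j * expR (s * F (l' j)))) *
     \det (toeplitz m l' p (fun j => (l' j)^-1 * (om' j * expR (s * F (l' j)))))).
  have oE j : (j < m.+1)%N ->
      om' j * expR (s * F (l' j)) = om (m - j)%N * expR (- s * - F (l (m - j)%N)).
    by move=> jm; rewrite (revE j jm).1 (revE j jm).2 mulrNN.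
  have o'E j : (j < m.+1)%N -> (l' j)^-1 * (om' j * expR (s * F (l' j))) =
      (l (m - j)%N)^-1 * (om (m - j)%N * expR (- s * - F (l (m - j)%N))).
    by move=> jm; rewrite oE // (revE j jm).1.
  rewrite !(toeplitz_revE _ (fun j => om j * expR (- s * - F (l j))) _ oE).
  rewrite !(toeplitz_revE _ (fun j => (l j)^-1 * (om j * expR (- s * - F (l j)))) _ o'E).
  exact: toeplitzE.
have := toeplitz_ratio_cvg l'_inj l'_neq0 om'_neq0 dphi pm
  (beta := fun s => b p.+1 (- s)) toeplitzNE.
set c := (_ * _ ^+ 2) => cvg2.
have /asymptotic_equiv[e e0 eE] : b p.+1 t / (c * expR (- t * (F (l' p.+1) - F (l' p))))
    @[t --> -oo] --> (1 : R).
  apply/cvgNy_compNP; rewrite /comp; under eq_fun => s do rewrite opprK.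
  exact: cvg2.
exists e => //; apply: filterS eE => t ->.
(* Here [N - n] is [m - p]; the products of the statement are reindexed by [i -> N - i]. *)
rewrite /c /l' /om' !subSS (subSn (_ : p <= m)%N); last by lia.
have := @prod_nat_sub _ (fun i => lam (m - p)%N - lam i) m.+1 p.+1 (ltnW pm).
have := @prod_nat_sub _ (fun i => lam (m - p).+1 - lam i) m.+1 p (ltnW (ltnW pm)).
rewrite subSS (subSn (_ : p <= m)%N); last by lia.
move=> -> ->; rewrite mulNr -mulrN opprB.
by congr (_ * _ * _ * _); rewrite invfM mulrACA.
Qed.
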